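(* Let $K[\mathcal S]$ be a $2$-dimensional simplicial semigroup ring (so $d=2$), and let $$\Delta=\{s\in\mathcal S \mid s-a_{n-1}\in\mathcal S,\ s-a_n\in\mathcal S \text{ and } s-a_n-a_{n-1}\notin\mathcal S\}.$$ Then $\mathcal S_1=\Delta$, where $\mathcal S_1$ is the set of shifts in the second step of the multigraded Noether resolution of $K[\mathcal S]$.
   Context: $K$ is an infinite field. $\mathcal A=\{a_1,\dots,a_n\}\subset\mathbb N^2$ is a set of nonzero vectors with $a_{n-1}=(\omega_{n-1},0)$ and $a_n=(0,\omega_n)$, where $\omega_{n-1},\omega_n\in\mathbb Z^+$. $\mathcal S\subset\mathbb N^2$ is the semigroup (with $0$) generated by $\mathcal A$, and $K[\mathcal S]=K[t^s\mid s\in\mathcal S]$, where $t^s=t_1^{s_1}t_2^{s_2}$. One has $K[\mathcal S]\simeq K[x_1,\dots,x_n]/I_{\mathcal A}$, where $I_{\mathcal A}$ is the kernel of $x_i\mapsto t^{a_i}$; it is multigraded by $\deg_{\mathcal S}(x_i)=a_i$. The ring $A=K[x_{n-1},x_n]$ is a Noether normalization of $K[\mathcal S]$ (via $x_{n-1}\mapsto t^{a_{n-1}}$, $x_n\mapsto t^{a_n}$). The multigraded Noether resolution of $K[\mathcal S]$ is its minimal multigraded free resolution as $A$-module, $$0\to\bigoplus_{s\in\mathcal S_p}A\cdot s\to\cdots\to\bigoplus_{s\in\mathcal S_1}A\cdot s\to\bigoplus_{s\in\mathcal S_0}A\cdot s\to K[\mathcal S]\to0,$$ where the $\mathcal S_i$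 are finite subsets of $\mathcal S$ and $A\cdot s$ denotes the shift of $A$ by $s$ (a free module of rank one generated in multidegree $s$); $\mathcal S_1=\emptyset$ if $p=0$. *)

(* Defs.v *)
From HB Require Import structures.
From mathcomp Require Import all_boot all_order all_algebra.
From mathcomp Require Export mpoly.

Set Implicit Arguments.
Unset Strict Implicit.
Unset Printing Implicit Defensive.

Import GRing.Theory.
Local Open Scope ring_scope.

(* Vectors of N^2, monomials of K[t_1, t_2] and monomials of
   the Noether normalization A = K[x_{n-1}, x_n] are all elements of
   'X_{1..2}.  The n >= 2 generators a_1, ..., a_n are a family indexed by
   'I_n with n written m.+2. *)

Definition infinite_field (K : fieldType) : Prop :=
  forall s : seq K, exists x : K, x \notin s.

Section Semigroup.

Variables (m : nat) (a : 'I_m.+2 -> 'X_{1..2}).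

Definition gen_x : 'X_{1..2} := a (inord m).  (* a_{n-1} *)
Definition gen_y : 'X_{1..2} := a ord_max.    (* a_n *)

Definition simplicial2 : Prop :=
  [/\ forall i, a i != 0%MM,
      exists2 w : nat, (0 < w)%N & gen_x = [multinom [tuple w; 0%N]]
    & exists2 w : nat, (0 < w)%N & gen_y = [multinom [tuple 0%N; w]]].

Definition in_semigroup (s : 'X_{1..2}) : Prop :=
  exists c : 'I_m.+2 -> nat, s = (\sum_(i < m.+2) a i *+ c i)%MM.

(* s - b \in S with the difference taken in Z^2: the subtraction of
   'X_{1..2} is truncated and cannot be used here. *)
Definition diff_in_semigroup (s b : 'X_{1..2}) : Prop :=
  exists2 u, in_semigroup u & s = (u + b)%MM.

Definition Delta (s : 'X_{1..2}) : Prop :=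
  [/\ in_semigroup s,
      diff_in_semigroup s gen_x,
      diff_in_semigroup s gen_y
    & ~ diff_in_semigroup s (gen_y + gen_x)%MM].

(* The degree of a monomial of A. *)
Definition Adeg (u : 'X_{1..2}) : 'X_{1..2} :=
  (gen_x *+ u ord0 + gen_y *+ u ord_max)%MM.

Variable K : fieldType.

(* K[S], the K-subalgebra of K[t_1, t_2] generated by the t^s, s \in S. *)
Inductive in_semigroup_ring : {mpoly K[2]} -> Prop :=
| SRconst (c : K) : in_semigroup_ring c%:MP
| SRmon s : in_semigroup s -> in_semigroup_ring 'X_[s]
| SRadd f g : in_semigroup_ring f -> in_semigroup_ring g ->
    in_semigroup_ring (f + g)
| SRmul f g : in_semigroup_ring f -> in_semigroup_ring g ->
    in_semigroup_ring (f * g).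

(* The map A -> K[S] sending x_{n-1} to t^{a_{n-1}} and x_n to t^{a_n}; it
   defines the A-module structure of K[S]. *)
Definition normalization : {mpoly K[2]} -> {mpoly K[2]} :=
  comp_mpoly [tuple 'X_[gen_x]; 'X_[gen_y]].

HB.instance Definition _ :=
  GRing.RMorphism.copy normalization
    (comp_mpoly [tuple 'X_[gen_x]; 'X_[gen_y]]).

(* The free A-module \bigoplus_(s <- S) A . s is 'rV[A]_(size S), its k-th
   basis vector having degree S_k; v is homogeneous of degree s when every
   monomial occurring in it has degree s (in particular when v = 0). *)
Definition free_homog (S : seq 'X_{1..2}) (s : 'X_{1..2})
    (v : 'rV[{mpoly K[2]}]_(size S)) : Prop :=
  forall (k : 'I_(size S)) (u : 'X_{1..2}),
    u \in msupp (v ord0 k) -> (Adeg u + nth 0%MM S k)%MM = s.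

Definition ring_homog (s : 'X_{1..2}) (f : {mpoly K[2]}) : Prop :=
  forall u, u \in msupp f -> u = s.

(* shifts i lists the degrees of a homogeneous basis of the i-th free module,
   with multiplicity. *)
Record noether_resolution := NoetherResolution {
  res_len : nat;
  shifts : nat -> seq 'X_{1..2};
  diff : forall i,
    {linear 'rV[{mpoly K[2]}]_(size (shifts i.+1)) ->
            'rV[{mpoly K[2]}]_(size (shifts i))};
  augm : {linear 'rV[{mpoly K[2]}]_(size (shifts 0)) -> {mpoly K[2]}
            | normalization \; *%R};
  res_finite : forall i, (res_len < i)%N -> shifts i = [::];
  diff_graded : forall i s v, free_homog s v -> free_homog s (diff i v);
  augm_graded : forall s v, free_homog s v -> ring_homog s (augm v);
  augm_onto : forall f, in_semigroup_ring f <-> exists v, augm v = f;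
  exact0 : forall v, augm v = 0 <-> exists w, diff 0 w = v;
  exactS : forall i v, diff i v = 0 <-> exists w, diff i.+1 w = v;
  (* the image of each differential lies in (x_{n-1}, x_n) times its target *)
  res_minimal : forall i v k, (diff i v ord0 k)@_0%MM = 0
}.

End Semigroup.

(* Main.v *)
Require Import Defs.
From mathcomp Require Import all_boot all_order all_algebra.

(* Let x, y denote both the variables of A and their degrees a_{n-1}, a_n; the
   argument identifies F_1/(x, y)F_1 with the first Koszul homology of K[S].
   A basis vector e of F_1 has d e = x p + y q, and (augm p, augm q) is a Koszul
   cycle: x augm p + y augm q = 0.  If augm p = 0, then p and q are boundaries,
   so e is congruent to a boundary modulo (x, y), which minimality forbids.
   The cycles of degree s modulo the trivial ones (-y r, x r) form a space of
   dimension 1 if s is in Delta and 0 otherwise.  Conversely, for s in Delta,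
   lift t^(s - x) and t^(s - y) to F_0 as p and q; then x p - y q = d v, and if
   no basis vector of F_1 had degree s, the syzygies of (x, y) in the free
   module F_0 would give t^(s - x) a component in y K[S], so s - x - y in S. *)

Set Implicit Arguments.
Unset Strict Implicit.
Unset Printing Implicit Defensive.

Import GRing.Theory.
Local Open Scope ring_scope.

(** * Coefficients and division by a monomial *)

Section Monomials.

Variables (n : nat) (K : fieldType).
Implicit Types (e u : 'X_{1..n}) (f g : {mpoly K[n]}).

Lemma mcoeffXM e g u :
  ('X_[e] * g)@_u = if (e <= u)%MM then g@_(u - e)%MM else 0.
Proof.
rewrite -commr_mpolyX; case: ifP => le_eu.
  by rewrite -[in LHS](submK le_eu) addmC mcoeffMX.
apply/eqP; rewrite mcoeff_eq0 (perm_mem (msuppMX _ _)).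
by apply: contraFN le_eu => /mapP[w _ ->]; apply: lem_addr.
Qed.

Lemma mcoeffXMD e g u : ('X_[e] * g)@_(u + e)%MM = g@_u.
Proof. by rewrite mcoeffXM lem_addl addmK. Qed.

Lemma mpolyX_neq0 e : 'X_[e] != 0 :> {mpoly K[n]}.
Proof. by rewrite -msupp_eq0 msuppX. Qed.

(** The quotient of [f] by ['X_[e]]: terms not divisible by ['X_[e]] are dropped, so no divisibility
    is required. *)
Lemma ex_mquo e f : exists g, forall u, g@_u = f@_(u + e)%MM.
Proof.
elim/mpolyind: f => [|c w f _ _ [g gE]].
  by exists 0 => u; rewrite !mcoeff0.
exists ((if (e <= w)%MM then c *: 'X_[w - e] else 0) + g) => u.
rewrite !mcoeffD gE; congr (_ + _); rewrite mcoeffZ mcoeffX.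
have [-> | neq_w] := eqVneq w (u + e)%MM.
  by rewrite lem_addl addmK mcoeffZ mcoeffX eqxx.
case: ifP => le_ew; last by rewrite mcoeff0 mulr0.
rewrite mcoeffZ mcoeffX; case: eqP => // eq_u.
by rewrite -eq_u submK ?eqxx in neq_w.
Qed.

Lemma divisible_mpolyX e f :
    (forall u, u \in msupp f -> (e <= u)%MM) ->
  exists2 g, f = 'X_[e] * g & forall u, g@_u = f@_(u + e)%MM.
Proof.
move=> le_f; have [g gE] := ex_mquo e f; exists g => //.
apply/mpolyP=> u; rewrite mcoeffXM; case: ifP => le_eu.
  by rewrite gE submK.
by apply/eqP; rewrite mcoeff_eq0; apply: contraFN le_eu; apply: le_f.
Qed.

Lemma mpolyX_single w f :
  (forall u, u \in msupp f -> u = w) -> f = f@_w *: 'X_[w].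
Proof.
move=> fw; apply/mpolyP=> u; rewrite mcoeffZ mcoeffX.
have [->|neq_wu] := eqVneq w u; first by rewrite mulr1.
rewrite mulr0; apply/eqP; rewrite mcoeff_eq0.
by apply: contraNN neq_wu => /fw->.
Qed.

Lemma lem_mnm1 (i : 'I_n) u : (U_(i) <= u)%MM = (0 < u i)%N.
Proof.
apply/mnm_lepP/idP=> [/(_ i)|u_gt0 j]; rewrite mnm1E ?eqxx //.
by case: eqP => // <-.
Qed.

End Monomials.

(** * The ideal of the two variables and its syzygies *)

Section TwoVariables.

Variable K : fieldType.
Implicit Types f p q : {mpoly K[2]}.

(** A nonconstant monomial goes to [p] if the first variable divides it, and to [q] otherwise.
    Nothing cancels, so the support conditions preserve homogeneity. *)
Lemma mpoly2_split f :
  exists p q,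
  [/\ f = (f@_0%MM)%:MP + ('X_ord0 * p + 'X_ord_max * q),
      forall u, u \in msupp p -> (u + U_(ord0))%MM \in msupp f
    & forall u, u \in msupp q -> (u + U_(ord_max))%MM \in msupp f].
Proof.
have [p pE] := ex_mquo U_(ord0) f.
(* [h] collects the nonconstant terms free of the first variable; the second one must divide
   them. *)
pose h := f - (f@_0%MM)%:MP - 'X_ord0 * p.
have hE u : h@_u = if (u != 0%MM) && (u ord0 == 0%N) then f@_u else 0.
  rewrite !mcoeffB mcoeffC mcoeffXM lem_mnm1.
  have [->|nz_u] := eqVneq u 0%MM; first by rewrite mnm0E /= mulr1 !subrr.
  rewrite mulr0 subr0 /= lt0n; case: eqVneq => /= [|u0]; first by rewrite subr0.
  by rewrite pE submK ?lem_mnm1 ?lt0n ?subrr.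
have [u|q hq qE] := @divisible_mpolyX _ _ U_(ord_max) h.
  rewrite mcoeff_msupp hE lem_mnm1 lt0n.
  case: ifP => [/andP[nz_u /eqP u0] _|]; last by rewrite eqxx.
  apply: contraNneq nz_u => u1; apply/eqP/mnmP=> i; rewrite mnm0E.
  have [->|] := eqVneq i ord0; first exact: u0.
  case: i => -[|[|//]] lt_i //= _; rewrite -[RHS]u1.
  by congr (u _); apply: val_inj.
exists p, q; split=> [|u|u]; rewrite ?mcoeff_msupp ?pE //.
  by rewrite -hq [_ + h]addrC subrK addrC subrK.
by rewrite qE hE; case: ifP; rewrite ?eqxx.
Qed.

(** The two variables form a regular sequence: a monomial of [p] stays divisible by the second
    variable once the factor ['X_ord0] is removed. *)
Lemma mpoly2_syzygy p q :
  'X_ord0 * p = 'X_ord_max * q -> exists r, p = 'X_ord_max * r.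
Proof.
move=> eq_pq; have [u|r pr _] := @divisible_mpolyX _ _ U_(ord_max) p.
  rewrite mcoeff_msupp -(mcoeffXMD U_(ord0)) eq_pq mcoeffXM !lem_mnm1.
  by rewrite mnmDE mnm1E addn0; case: ifP => //; rewrite eqxx.
by exists r.
Qed.

End TwoVariables.

(** The constant part is expanded in the standard basis so that a differential can be applied to it
    term by term. *)
Lemma free_split (K : fieldType) N (v : 'rV[{mpoly K[2]}]_N) :
  exists p q : 'rV[{mpoly K[2]}]_N,
  [/\ v = \sum_k ((v ord0 k)@_0%MM)%:MP *: delta_mx ord0 k
            + ('X_ord0 *: p + 'X_ord_max *: q),
      forall k u, u \in msupp (p ord0 k) ->
        (u + U_(ord0))%MM \in msupp (v ord0 k)
    & forall k u, u \in msupp (q ord0 k) ->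
        (u + U_(ord_max))%MM \in msupp (v ord0 k)].
Proof.
have [p /fin_all_exists[q pqP]] :=
  fin_all_exists (fun k => mpoly2_split (v ord0 k)).
exists (\row_k p k), (\row_k q k); split=> [|k u|k u].
- pose c : 'rV[{mpoly K[2]}]_N := \row_k ((v ord0 k)@_0%MM)%:MP.
  rewrite (_ : \sum_k _ = c); last first.
    by rewrite [RHS]row_sum_delta; apply: eq_bigr => k _; rewrite [c _ _]mxE.
  by apply/rowP=> k; rewrite !mxE; have [+ _ _] := pqP k.
- by rewrite mxE; have [_ + _] := pqP k; apply.
- by rewrite mxE; have [_ _ +] := pqP k; apply.
Qed.

(** * The semigroup and the degrees of monomials of [A] *)

Section Degrees.

Variables (m : nat) (a : 'I_m.+2 -> 'X_{1..2}) (K : fieldType).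

Lemma in_semigroupD s t :
  in_semigroup a s -> in_semigroup a t -> in_semigroup a (s + t)%MM.
Proof.
move=> [c ->] [d ->]; exists (fun i => (c i + d i)%N).
rewrite -big_split; apply: eq_bigr => i _.
by apply/mnmP=> j; rewrite !(mnmDE, mulmnE) mulnDr.
Qed.

Lemma in_semigroup_gen i : in_semigroup a (a i).
Proof.
exists (fun j => nat_of_bool (j == i)).
rewrite (bigD1 i) //= eqxx big1 => [|j /negPf->].
  by rewrite addm0 mulm1n.
exact: mulm0n.
Qed.

Lemma semigroup_ring_msupp (f : {mpoly K[2]}) u :
  in_semigroup_ring a f -> u \in msupp f -> in_semigroup a u.
Proof.
move=> Sf; elim: Sf u => {f} [c|s Ss|f g _ IHf _ IHg|f g _ IHf _ IHg] u.
- rewrite msuppC; case: eqP => // _; rewrite inE => /eqP->.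
  exists (fun=> 0%N); rewrite big1 // => i _; apply: mulm0n.
- by rewrite msuppX inE => /eqP->.
- by move/msuppD_le; rewrite mem_cat => /orP[/IHf|/IHg].
- move/msuppM_le => /allpairsP[[v w] [/IHf Sv /IHg Sw ->]].
  exact: in_semigroupD.
Qed.

Lemma Adeg0 : Adeg a 0%MM = 0%MM.
Proof. by rewrite /Adeg !mnm0E !mulm0n addm0. Qed.

Lemma AdegDx u : Adeg a (u + U_(ord0))%MM = (Adeg a u + gen_x a)%MM.
Proof.
apply/mnmP=> j; rewrite /Adeg !(mnmDE, mulmnE) !mnm1E /= addn0 addn1 mulnS.
by rewrite -addnA addnC.
Qed.

Lemma AdegDy u : Adeg a (u + U_(ord_max))%MM = (Adeg a u + gen_y a)%MM.
Proof.
apply/mnmP=> j; rewrite /Adeg !(mnmDE, mulmnE) !mnm1E /= addn0 addn1 mulnS.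
by rewrite addnCA addnC.
Qed.

End Degrees.

(** * The first differential and Koszul cycles of [K[S]] *)

Section Resolution.

Variables (m : nat) (a : 'I_m.+2 -> 'X_{1..2}) (K : fieldType).
Variable F : noether_resolution a K.

Local Notation x := (gen_x a).
Local Notation y := (gen_y a).
Local Notation free i := 'rV[{mpoly K[2]}]_(size (shifts F i)).

Lemma augmZx (p : free 0) : augm F ('X_ord0 *: p) = 'X_[x] * augm F p.
Proof. by rewrite linearZ /= /normalization comp_mpolyXU. Qed.

Lemma augmZy (p : free 0) : augm F ('X_ord_max *: p) = 'X_[y] * augm F p.
Proof. by rewrite linearZ /= /normalization comp_mpolyXU. Qed.

Lemma augm_diff v : augm F (diff F 0 v) = 0.
Proof. by apply/exact0; exists v. Qed.

Lemma augm_msupp (p : free 0) u : u \in msupp (augm F p) -> in_semigroup a u.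
Proof. by apply: semigroup_ring_msupp; apply/(augm_onto F); exists p. Qed.

Lemma augm_lift s : in_semigroup a s -> exists p, augm F p = 'X_[s].
Proof. by move=> Ss; apply/(augm_onto F)/SRmon. Qed.

(** Says that [augm F p] has degree [s - e], in additive form because [s - e] may fall outside
    N^2. *)
Lemma augm_shift e s (p : free 0) :
    (forall k u, u \in msupp (p ord0 k) ->
       (Adeg a u + nth 0 (shifts F 0) k + e)%MM = s) ->
  forall u, u \in msupp (augm F p) -> (u + e)%MM = s.
Proof.
move=> hp u; have [le_es|lt_es] := boolP (e <= s)%MM.
  suff ph: free_homog a (s - e)%MM p by move/(augm_graded ph)->; rewrite submK.
  by move=> k w /hp <-; rewrite addmK.
(* When [e <= s] fails, no monomial can satisfy the degree condition. *)
suff -> : p = 0 by rewrite linear0 msupp0.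
apply/rowP=> k; rewrite mxE; apply/eqP; rewrite -msupp_eq0.
case def_r: (msupp _) => [|w r] //; case/negP: lt_es.
by rewrite -(hp k w) ?lem_addl // def_r mem_head.
Qed.

Lemma diff_split s v : free_homog a s v ->
  exists p q,
  [/\ diff F 0 v = 'X_ord0 *: p + 'X_ord_max *: q,
      forall u, u \in msupp (augm F p) -> (u + x)%MM = s
    & forall u, u \in msupp (augm F q) -> (u + y)%MM = s].
Proof.
move=> hv; have [p [q [dv hp hq]]] := free_split (diff F 0 v).
exists p, q; split.
(* Minimality removes the constant part of the splitting. *)
- rewrite [LHS]dv big1 ?add0r // => k _.
  by rewrite res_minimal mpolyC0 scale0r.
- apply: augm_shift => k u /hp/(diff_graded hv) <-.
  by rewrite AdegDx -!addmA (addmC x).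
- apply: augm_shift => k u /hq/(diff_graded hv) <-.
  by rewrite AdegDy -!addmA (addmC y).
Qed.

Lemma augm_syzygy v p q :
    diff F 0 v = 'X_ord0 *: p + 'X_ord_max *: q ->
  'X_[x] * augm F p = - ('X_[y] * augm F q).
Proof.
move=> dv; apply/eqP; rewrite -addr_eq0 -augmZx -augmZy -linearD -dv.
by rewrite augm_diff.
Qed.

Lemma syzygy_eq0 v p q :
    diff F 0 v = 'X_ord0 *: p + 'X_ord_max *: q ->
  (augm F p == 0) = (augm F q == 0).
Proof.
move/augm_syzygy/(congr1 (fun f => f == 0)).
by rewrite oppr_eq0 !mulf_eq0 !(negPf (mpolyX_neq0 _ _)).
Qed.

(* The hypothesis also forces [augm F q = 0].  Writing p = d p' and q = d q',
   the vector v - x p' - y q' is a cycle, hence a boundary, and boundaries have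
   no constant coefficients. *)
Lemma trivial_syzygy_coeff0 v p q k :
    diff F 0 v = 'X_ord0 *: p + 'X_ord_max *: q -> augm F p = 0 ->
  (v ord0 k)@_0%MM = 0.
Proof.
move=> dv p0; have /eqP q0: augm F q == 0 by rewrite -(syzygy_eq0 dv) p0.
have [p' dp] := (exact0 p).1 p0; have [q' dq] := (exact0 q).1 q0.
have /exactS[w dw]: diff F 0 (v - ('X_ord0 *: p' + 'X_ord_max *: q')) = 0.
  by rewrite linearB linearD !linearZ /= dp dq dv subrr.
have := res_minimal w k; rewrite dw !mxE mcoeffB mcoeffD !mcoeffXM !lem_mnm1.
by rewrite !mnm0E /= addr0 subr0.
Qed.

Lemma homog_delta (k : 'I_(size (shifts F 1))) :
  free_homog a (nth 0%MM (shifts F 1) k) (delta_mx ord0 k : free 1).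
Proof.
move=> l u; rewrite mxE eqxx; case: eqP => [->|_] /=; last by rewrite msupp0.
by rewrite msupp1 inE => /eqP->; rewrite Adeg0 add0m.
Qed.

(** A basis vector has constant coefficient 1 at its own index, so its cycle cannot have
    [augm F p = 0]. *)
Lemma basis_syzygy (k : 'I_(size (shifts F 1))) (s := nth 0%MM (shifts F 1) k) :
  exists p q,
  [/\ diff F 0 (delta_mx ord0 k) = 'X_ord0 *: p + 'X_ord_max *: q,
      augm F p != 0,
      forall u, u \in msupp (augm F p) -> (u + x)%MM = s
    & forall u, u \in msupp (augm F q) -> (u + y)%MM = s].
Proof.
have [p [q [de hp hq]]] := diff_split (@homog_delta k).
exists p, q; split=> //; apply: contra_neq (oner_neq0 K) => p0.
by have := trivial_syzygy_coeff0 k de p0; rewrite mxE !eqxx mcoeff1 eqxx.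
Qed.

(** Monomials of the nonzero [augm F p] and [augm F q] put [s - x] and [s - y] in S. If
    [t = s - x - y] were in S too, a lift of [t^t] would give a trivial cycle cancelling that of the
    basis vector. *)
Lemma shifts1_Delta (k : 'I_(size (shifts F 1))) :
  Delta a (nth 0%MM (shifts F 1) k).
Proof.
have [p [q [de nz_p hp hq]]] := basis_syzygy k.
set s := nth _ _ _ in hp hq *.
have nz_q : augm F q != 0 by rewrite -(syzygy_eq0 de).
have ex_msupp (f : {mpoly K[2]}) : f != 0 -> exists u, u \in msupp f.
  by rewrite -msupp_eq0; case: (msupp f) => // u r _; exists u; apply: mem_head.
have [u pu] := ex_msupp _ nz_p; have [w qw] := ex_msupp _ nz_q.
have [Su Sw] := (augm_msupp pu, augm_msupp qw).
split; [|by exists u; rewrite ?(hp u)|by exists w; rewrite ?(hq w)|].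
  by rewrite -(hp u pu); apply: in_semigroupD => //; apply: in_semigroup_gen.
case=> t St def_s; have [r augm_r] := augm_lift St.
pose b := (augm F p)@_(t + y)%MM; have augm_p : augm F p = b *: 'X_[t + y].
  by apply: mpolyX_single => v /hp; rewrite def_s addmA => /addIm.
pose c : {mpoly K[2]} := b%:MP.
(* Adding a trivial syzygy leaves the image of the basis vector unchanged, while [augm] now kills
   the first component. *)
have de' : diff F 0 (delta_mx ord0 k) =
    'X_ord0 *: (p - 'X_ord_max *: (c *: r))
      + 'X_ord_max *: (q + 'X_ord0 *: (c *: r)).
  move: (c *: r) => z; rewrite de scalerBr scalerDr !scalerA addrACA.
  by rewrite ['X_ord_max * _]mulrC addNr addr0.
have := trivial_syzygy_coeff0 k de'; rewrite mxE !eqxx mcoeff1 eqxx.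
case/(_ _)/eqP/idPn; last exact: oner_neq0.
rewrite linearB /= augmZy linearZ /= /normalization comp_mpolyC augm_r.
by rewrite augm_p mpolyXD mulrCA mul_mpolyC (mulrC 'X_[y]) subrr.
Qed.

(** Two basis vectors of the same degree have first components mapped to multiples of one monomial
    ['X_[u]], hence proportional. *)
Lemma shifts1_uniq : uniq (shifts F 1).
Proof.
apply/(uniqP 0%MM) => k l lt_k lt_l eq_s.
have [pk [qk [dk _ hpk _]]] := basis_syzygy (Ordinal lt_k).
have [pl [ql [dl nz_pl hpl _]]] := basis_syzygy (Ordinal lt_l).
have [_ [u _ def_s] _ _] := shifts1_Delta (Ordinal lt_l).
have pkE : augm F pk = (augm F pk)@_u *: 'X_[u].
  by apply: mpolyX_single => w /hpk; rewrite /= eq_s def_s => /addIm.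
have plE : augm F pl = (augm F pl)@_u *: 'X_[u].
  by apply: mpolyX_single => w /hpl; rewrite def_s => /addIm.
apply/eqP; apply: contraNT nz_pl => neq_kl.
rewrite plE; suff -> : (augm F pl)@_u = 0 by rewrite scale0r.
pose b p := (augm F p)@_u; pose c (p : free 0) : {mpoly K[2]} := (b p)%:MP.
pose e k : free 1 := delta_mx ord0 k.
(* The coefficients make the first components cancel under [augm]; the constant coefficient at index
   [k], namely [b pl], must then vanish. *)
have dv : diff F 0 (c pl *: e (Ordinal lt_k) - c pk *: e (Ordinal lt_l)) =
    'X_ord0 *: (c pl *: pk - c pk *: pl)
      + 'X_ord_max *: (c pl *: qk - c pk *: ql).
  rewrite linearB !linearZ /= dk dl !(scalerDr, scalerN, scalerA) opprD addrACA.
  by rewrite ![c _ * _]mulrC.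
have := trivial_syzygy_coeff0 (Ordinal lt_k) dv.
rewrite !mxE !eqxx -val_eqE /= (negPf neq_kl) mulr0 subr0 mulr1.
rewrite mcoeffC eqxx mulr1; apply.
rewrite linearB !linearZ /= /normalization !comp_mpolyC.
by rewrite !mul_mpolyC [augm F pk]pkE [augm F pl]plE !scalerA mulrC subrr.
Qed.

Lemma Delta_shifts1 s : Delta a s -> s \in shifts F 1.
Proof.
case=> _ [sx Sx def_sx] [sy Sy def_sy] notS.
have [p augm_p] := augm_lift Sx; have [q augm_q] := augm_lift Sy.
have /exact0[v dv]: augm F ('X_ord0 *: p - 'X_ord_max *: q) = 0.
  rewrite linearB augmZx augmZy augm_p augm_q -!mpolyXD.
  by rewrite addmC -def_sx addmC -def_sy subrr.
apply/negPn/negP=> notin_s.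
have [v1 [v2 [def_v _ _]]] := free_split v.
have [pk /fin_all_exists[qk dk]] := fin_all_exists basis_syzygy.
pose c k : {mpoly K[2]} := ((v ord0 k)@_0%MM)%:MP.
(* [P] and [Q] come from moving the expansion of [d v] to the left of [x p - y q = d v] and grouping
   the multiples of [x] and of [y]. *)
pose P := p - \sum_k c k *: pk k - diff F 0 v1.
pose Q := q + \sum_k c k *: qk k + diff F 0 v2.
have eqPQ : 'X_ord0 *: P = 'X_ord_max *: Q.
  have dvE : diff F 0 v = 'X_ord0 *: \sum_k c k *: pk k
      + 'X_ord_max *: \sum_k c k *: qk k
      + ('X_ord0 *: diff F 0 v1 + 'X_ord_max *: diff F 0 v2).
    rewrite {1}def_v linearD linear_sum linearD !linearZ /=; congr (_ + _).
    rewrite !scaler_sumr -big_split; apply: eq_bigr => k _.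
    have [de _ _ _] := dk k; rewrite linearZ /= de scalerDr !scalerA.
    by rewrite ![c k * _]mulrC.
  rewrite dv in dvE; apply/eqP; rewrite !scalerBr !scalerDr !subr_eq.
  move/eqP: dvE; rewrite subr_eq => /eqP->.
  by rewrite (AC (2*2*1) (5*2*4*3*1)).
have [r Pr] : exists r, P = 'X_ord_max *: r.
  have /fin_all_exists[r rE] k : exists rk, P ord0 k = 'X_ord_max * rk.
    apply: (@mpoly2_syzygy _ _ (Q ord0 k)).
    by have /rowP/(_ k) := eqPQ; rewrite !mxE.
  by exists (\row_k r k); apply/rowP=> k; rewrite rE !mxE.
(* Boundaries vanish under [augm], and [augm F (pk k)] could meet degree [sx] only if the [k]-th
   shift were [s]. *)
have : (augm F P)@_sx = 1.
  rewrite !linearB /= augm_diff mcoeff0 subr0 augm_p mcoeffX eqxx.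
  rewrite linear_sum raddf_sum big1 ?subr0 // => k _.
  have [_ _ hp _] := dk k.
  rewrite linearZ /= /normalization comp_mpolyC mcoeffCM.
  suff -> : (augm F (pk k))@_sx = 0 by rewrite mulr0.
  apply/eqP; rewrite mcoeff_eq0; apply: contra notin_s => /hp.
  by rewrite -def_sx => ->; apply: mem_nth.
(* As [P] is a multiple of [y], this coefficient 1 sits at exponent [sx - y] in [augm F r], which
   puts [s - x - y] in S. *)
rewrite Pr augmZy mcoeffXM; case: ifP => [le_y|_]; last first.
  by move/esym/eqP; rewrite oner_eq0.
move=> r1; apply: notS; exists (sx - y)%MM.
  by apply: (@augm_msupp r); rewrite mcoeff_msupp r1 oner_neq0.
by rewrite addmA submK.
Qed.

End Resolution.

Theorem theorem2 (K : fieldType) (m : nat) (a : 'I_m.+2 -> 'X_{1..2}) :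
  infinite_field K ->
  simplicial2 a ->
  forall F : noether_resolution a K,
    uniq (shifts F 1) /\ (forall s : 'X_{1..2}, s \in shifts F 1 <-> Delta a s).
Proof.
move=> _ _ F; split=> [|s]; first exact: shifts1_uniq.
split=> [/(nthP 0%MM)[k lt_k <-]|]; last exact: Delta_shifts1.
exact: (shifts1_Delta (Ordinal lt_k)).
Qed.
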